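(* Let $n\in\mathbb{N}$, let $B=(\{0,1\}^n,\le)$, let $L_D$ be the free distributive lattice with $n$ generators $w_1,\ldots,w_n$ (with bottom and top included, as described in the context), and let $\overline{\beta}:B\to L_D$ be defined by $\overline{\beta}(x)=\bigvee_{i=1}^n (w_i\cdot x_i)$ for $x=(x_1,\ldots,x_n)\in B$. Then every up-set of $B$ is a cut of $\overline{\beta}$; that is, for every up-set $F\subseteq B$ there is $t\in L_D$ such that $F=\{x\in B\mid \overline{\beta}(x)\ge t\}$.
   Context: $B=\{0,1\}^n$ is ordered componentwise with respect to $0\le 1$. An up-set of a poset $(P,\le)$ is a subset $F\subseteq P$ such that $x\in F$, $y\in P$ and $x\le y$ imply $y\in F$. The free distributive lattice $L_D$ with $n$ generators $w_1,\ldots,w_n$ is taken with the join and the meet of the empty set of generators also counted, as the bottom $0$ and the top $1$ of $L_D$ respectively (i.e., it is the free bounded distributive lattice on $w_1,\ldots,w_n$; it is finite, hence complete). For $w\in L_D$ and $x\in\{0,1\}$, $w\cdot x\in L_D$ is defined by $w\cdot 1=w$ and $w\cdot 0=0$ (the bottom of $L_D$). For a complete lattice $L$, a function $\mu:B\to L$ and $p\in L$, the cut ($p$-cut) of $\mu$ is $\mu_p=\{x\in B\mid \mu(x)\ge p\}$. *)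

(* Defs.v *)
From mathcomp Require Import all_boot all_order.

Set Implicit Arguments.
Unset Strict Implicit.
Unset Printing Implicit Defensive.

Import Order.TTheory.
Local Open Scope order_scope.

(* The tuple alias carrying the componentwise order; false < true in bool. *)
Definition cube (n : nat) := n.-tupleprod bool.

Definition is_upset (d : Order.disp_t) (P : finPOrderType d) (F : {set P}) :
    Prop :=
  forall x y : P, x \in F -> x <= y -> y \in F.

(* Not the library's {tblmorphism L -> M}, which only records preservation of
   \bot and \top and says nothing about binary meets and joins. *)
Definition is_tb_lattice_morphism (d d' : Order.disp_t)
    (L : tbLatticeType d) (M : tbLatticeType d') (g : L -> M) : Prop :=
  [/\ Order.meet_morphism g, Order.join_morphism g,
      g \bot = \bot & g \top = \top].

(* Universal property of the free bounded distributive lattice on the family w.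
   A tbDistrLatticeType may be trivial, i.e., \bot = \top is allowed in M. *)
Definition is_free_distr_lattice (I : Type) (d : Order.disp_t)
    (L : tbDistrLatticeType d) (w : I -> L) : Prop :=
  forall (d' : Order.disp_t) (M : tbDistrLatticeType d') (f : I -> M),
  exists g : L -> M,
    [/\ is_tb_lattice_morphism g,
        (forall i : I, g (w i) = f i)
      & (forall h : L -> M, is_tb_lattice_morphism h ->
           (forall i : I, h (w i) = f i) -> h =1 g)].

Definition bit_scale (d : Order.disp_t) (L : bPOrderType d) (w : L) (b : bool) :
    L :=
  if b then w else \bot.

Definition beta_bar (d : Order.disp_t) (L : tbDistrLatticeType d) (n : nat)
    (w : 'I_n -> L) (x : cube n) : L :=
  \join_(i < n) bit_scale (w i) (tnth x i).

Definition cut (T : finType) (d : Order.disp_t) (L : porderType d)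
    (mu : T -> L) (p : L) : {set T} :=
  [set x | p <= mu x].

(* Main.v *)
Require Import Defs.
From mathcomp Require Import all_boot all_order.

Set Implicit Arguments.
Unset Strict Implicit.
Unset Printing Implicit Defensive.

Import Order.TTheory.
Local Open Scope order_scope.

(** Write b for [beta_bar w]. Since b is a function on a finite set, F can only
    be a cut if it is the cut at t, the meet of b x over x in F, and F is
    clearly contained in that cut. The content is that no y outside F lies in
    it. Freeness yields a homomorphism g from L to the two-element lattice
    sending w_i to the negation of y_i. As b x is the join of the w_i with
    x_i = 1, g (b x) is true exactly when x_i = 1 and y_i = 0 for some i, that
    is, when x is not below y ([beta_bar_separation]). Hence g (b y) is false.
    But F is an up-set avoiding y, so no x in F is below y, and g sends every
    b x with x in F, hence also t, to true. Homomorphisms being monotone, t is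
    not below b y. *)

Section BoundedLatticeMorphisms.

Variables (d d' : Order.disp_t) (L : tbLatticeType d) (M : tbLatticeType d').
Variables (g : L -> M) (g_morph : is_tb_lattice_morphism g).

Lemma tb_morphism_bigjoin (I : Type) (r : seq I) (P : pred I) (E : I -> L) :
  g (\join_(i <- r | P i) E i) = \join_(i <- r | P i) g (E i).
Proof. by case: g_morph => _ gU g0 _; apply: big_morph. Qed.

Lemma tb_morphism_bigmeet (I : Type) (r : seq I) (P : pred I) (E : I -> L) :
  g (\meet_(i <- r | P i) E i) = \meet_(i <- r | P i) g (E i).
Proof. by case: g_morph => gI _ _ g1; apply: big_morph. Qed.

Lemma tb_morphism_homo (a b : L) : a <= b -> g a <= g b.
Proof.
case: g_morph => gI _ _ _ /meet_idPl ab.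
by apply/meet_idPl; rewrite -gI ab.
Qed.

End BoundedLatticeMorphisms.

Lemma bigjoin_boolE (n : nat) (E : 'I_n -> bool) :
  \join_(i < n) E i = [exists i, E i].
Proof.
apply/idP/idP => [|/existsP[i Ei]].
  by apply: contraLR => /existsPn nE; rewrite big1 // => i _; apply/negbTE.
by have := joins_sup (P := xpredT) (j := i) E isT; rewrite Ei; case: (\join_i _).
Qed.

(** Composing [beta_bar w] with the two-valued homomorphism that negates the
    coordinates of y gives the indicator of the complement of the principal
    down-set of y; these are the tests that separate F from its complement. *)
Lemma beta_bar_separation (n : nat) (d : Order.disp_t) (L : tbDistrLatticeType d)
    (w : 'I_n -> L) (y : cube n) (g : L -> bool) :
    is_tb_lattice_morphism g -> (forall i, g (w i) = ~~ tnth y i) ->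
  forall x : cube n, g (beta_bar w x) = ~~ (x <= y).
Proof.
move=> gM gw x; have [_ _ g0 _] := gM.
rewrite (tb_morphism_bigjoin gM) bigjoin_boolE leEtprod negb_forall.
apply: eq_existsb => i.
by rewrite /bit_scale; case: (tnth x i); rewrite ?gw ?g0; case: (tnth y i).
Qed.

Theorem theorem4p1 (n : nat) (d : Order.disp_t) (L : tbDistrLatticeType d)
    (w : 'I_n -> L) (w_free : is_free_distr_lattice w)
    (F : {set cube n}) (F_up : is_upset F) :
  exists t : L, F = cut (beta_bar w) t.
Proof.
exists (\meet_(x in F) beta_bar w x).
apply/setP => y; rewrite inE; apply/idP/idP => [yF|]; first exact: meets_inf.
apply: contraLR => yF.
have [g [gM gw _]] := w_free _ _ (fun i => ~~ tnth y i).
have gb := beta_bar_separation gM gw.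
apply/negP => /(tb_morphism_homo gM).
(* Every factor of g t is true, so g t is the empty-meet value \top = true. *)
rewrite (tb_morphism_bigmeet gM) gb lexx big1 // => x xF.
by rewrite gb; apply: contra yF; apply: F_up.
Qed.
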